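(* Any torsion-free abelian group $G$ is totally $s$-orderable, i.e. $\mathrm{Sp}_{\rm so}(G)=\omega\setminus\{0,1\}$.
   Context: Here $\omega=\{0,1,2,\ldots\}$. For a natural number $n\ge 2$, an $n$-ary relation $K_n\subseteq Z^n$ on a set $Z$ is an $n$-spherical order if: (nso1) for every even permutation $\sigma$ of $\{1,\ldots,n\}$ and all $x_1,\ldots,x_n\in Z$, $K_n(x_1,\ldots,x_n)$ implies $K_n(x_{\sigma(1)},\ldots,x_{\sigma(n)})$; (nso2) for all $1\le i<j\le n$ and all $x_1,\ldots,x_n\in Z$: both $K_n(x_1,\ldots,x_i,\ldots,x_j,\ldots,x_n)$ and $K_n(x_1,\ldots,x_j,\ldots,x_i,\ldots,x_n)$ (the tuple with the $i$-th and $j$-th entries swapped) hold if and only if $x_k=x_l$ for some $1\le k<l\le n$; (nso3) for all $x_1,\ldots,x_n\in Z$, if $K_n(x_1,\ldots,x_n)$ then for every $t\in Z$ there is $i\in\{1,\ldots,n\}$ with $K_n(x_1,\ldots,x_{i-1},t,x_{i+1},\ldots,x_n)$; (nso4) for all $1\le i<j\le n$ and all $x_1,\ldots,x_n\in Z$: $K_n(x_1,\ldots,x_i,\ldots,x_j,\ldots,x_n)$ or $K_n(x_1,\ldots,x_j,\ldots,x_i,\ldots,x_n)$ holds. A group $G$ is $n$-spherically ordered by an $n$-spherical order $K_n$ on $G$ if for every $(x_1,\ldots,x_n)\in K_n$ and every $y\in G$ the tuples $(x_1y,\ldots,x_ny)$ and $(yx_1,\ldots,yx_n)$ belong to $K_n$.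 $G$ is $n$-spherically orderable if there is an $n$-spherical order on $G$ by which $G$ is $n$-spherically ordered. The spectrum of spherical orderability of $G$ is $\mathrm{Sp}_{\rm so}(G)=\{n\in\omega\setminus\{0,1\}\mid G\text{ is }n\text{-spherically orderable}\}$. $G$ is totally $s$-orderable if $\mathrm{Sp}_{\rm so}(G)=\omega\setminus\{0,1\}$. *)

(* Defs.v *)
From mathcomp Require Import all_boot all_fingroup all_classical.

Set Implicit Arguments.
Unset Strict Implicit.
Unset Printing Implicit Defensive.

Local Open Scope classical_set_scope.

Section SphericalOrder.
Variables (n : nat) (Z : Type).
Implicit Types (K : set (n.-tuple Z)) (x : n.-tuple Z).

Definition permute_tuple (s : 'S_n) x : n.-tuple Z := [tuple tnth x (s i) | i < n].

Definition subst_tuple x (i : 'I_n) (t : Z) : n.-tuple Z :=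
  [tuple if k == i then t else tnth x k | k < n].

Definition nso1 K : Prop :=
  forall (s : 'S_n) x, ~~ odd_perm s -> K x -> K (permute_tuple s x).

Definition nso2 K : Prop :=
  forall (i j : 'I_n) x, (i < j)%N ->
    (K x /\ K (permute_tuple (tperm i j) x)) <->
    exists k l : 'I_n, (k < l)%N /\ tnth x k = tnth x l.

Definition nso3 K : Prop :=
  forall x, K x -> forall t : Z, exists i : 'I_n, K (subst_tuple x i t).

Definition nso4 K : Prop :=
  forall (i j : 'I_n) x, (i < j)%N -> K x \/ K (permute_tuple (tperm i j) x).

(* The notion is only meaningful, and only used, for n >= 2. *)
Definition spherical_order K : Prop := [/\ nso1 K, nso2 K, nso3 K & nso4 K].

End SphericalOrder.

Section SphericallyOrderedGroups.
Variable G : groupType.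

Definition spherically_ordered (n : nat) (K : set (n.-tuple G)) : Prop :=
  spherical_order K /\
  forall (x : n.-tuple G) (y : G), K x ->
    K [tuple (tnth x i * y)%g | i < n] /\ K [tuple (y * tnth x i)%g | i < n].

Definition spherically_orderable (n : nat) : Prop :=
  exists K : set (n.-tuple G), spherically_ordered K.

Definition Sp_so : set nat :=
  [set n | (~` [set 0%N; 1%N]) n /\ spherically_orderable n].

Definition totally_s_orderable : Prop := Sp_so = ~` [set 0%N; 1%N].

Definition abelian_group : Prop := forall x y : G, commute x y.

Definition torsion_free : Prop :=
  forall (x : G) (m : nat), (0 < m)%N -> (x ^+ m)%g = 1%g -> x = 1%g.

End SphericallyOrderedGroups.

(* Main.v *)
Require Import Defs.
From mathcomp Require Import all_boot all_fingroup all_classical.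

(** A torsion-free abelian group carries a translation-invariant linear order:
    a maximal subsemigroup [M] with [M] and [M^-1] meeting only in [1] satisfies
    [M] U [M^-1] = [G], for otherwise some [g] could be adjoined to [M].
    Given such an order, put [x] in [K_n] when some even permutation sorts [x].
    An injective tuple is sorted by a unique permutation, while a tuple with a
    repeated entry is sorted by permutations of both parities; this gives nso2.
    For nso3, replacing by [t] the greatest entry below [t] (or the least entry,
    if there is none) keeps the tuple sorted by the same permutation. *)

Set Implicit Arguments.
Unset Strict Implicit.
Unset Printing Implicit Defensive.

(** * Sorting permutations and the spherical order of a linear order *)

Section EvenlySorted.
Variables (T : eqType) (le : rel T).
Hypotheses (le_total : total le) (le_trans : transitive le).
Hypothesis le_anti : antisymmetric le.
Variable n : nat.
Implicit Types (x : n.-tuple T) (r s : 'S_n).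

Definition sorts r x : Prop :=
  forall i j : 'I_n, i <= j -> le (tnth x (r i)) (tnth x (r j)).

Definition evenly_sorted : set (n.-tuple T) :=
  [set x | exists2 r, ~~ odd_perm r & sorts r x]%classic.

Let le_refl : reflexive le.
Proof. by move=> a; have := le_total a a; rewrite orbb. Qed.

Lemma sortsE r x : sorts r x <-> sorted le (permute_tuple r x).
Proof.
split=> [sr | sr i j leij].
  (* [nth] needs a default entry: the empty tuple is trivial, and a nonempty one supplies its head
     [x0]. *)
  case E: (val (permute_tuple r x)) => [//|x0 s]; rewrite -E.
  apply/(sortedP x0) => i; rewrite size_tuple => lti.
  have := sr (Ordinal (ltnW lti)) (Ordinal lti) (leqnSn i).
  by rewrite -!(tnth_mktuple (fun k => tnth x (r k))) !(tnth_nth x0).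
rewrite -!(tnth_mktuple (fun k => tnth x (r k))).
have x0 := tnth x i; rewrite !(tnth_nth x0).
by apply: (sorted_leq_nth le_trans le_refl _ sr) => //; rewrite inE size_tuple.
Qed.

Lemma sorts_exists x : exists r, sorts r x.
Proof.
have /tuple_permP [r Er] : perm_eq (sort le x) x by rewrite perm_sort.
by exists r; apply/sortsE; rewrite /permute_tuple -Er sort_sorted.
Qed.

Lemma perm_eq_permute_tuple r x : perm_eq (permute_tuple r x) x.
Proof. by apply/tuple_permP; exists r. Qed.

(** Antisymmetry makes the sorted rearrangement of [x] unique, so [r] and [s] pick equal entries at
    every rank. *)
Lemma sorts_inj r s x : injective (tnth x) -> sorts r x -> sorts s x -> r = s.
Proof.
move=> injx /sortsE sr /sortsE ss; apply/permP => i; apply: injx.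
have E : permute_tuple r x = permute_tuple s x.
  apply/val_inj/(sorted_eq le_trans le_anti sr ss).
  by rewrite (perm_trans (perm_eq_permute_tuple r x)) // perm_sym perm_eq_permute_tuple.
by have := congr1 (fun t => tnth t i) E; rewrite !tnth_mktuple.
Qed.

(** Products of permutations apply the left factor first, so [s^-1] cancels the [s] through which
    [permute_tuple s x] reads [x]. *)
Lemma sorts_permute r s x : sorts r x -> sorts (r * s^-1) (permute_tuple s x).
Proof. by move=> sr i j leij; rewrite !tnth_mktuple !permM !permKV; apply: sr. Qed.

Lemma sorts_permute_inv r s x : sorts r (permute_tuple s x) -> sorts (r * s) x.
Proof. by move=> sr i j /sr; rewrite !tnth_mktuple !permM. Qed.

Lemma sorts_tperm r (k l : 'I_n) x :
  tnth x k = tnth x l -> sorts r x -> sorts (r * tperm k l) x.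
Proof.
move=> Ekl sr i j /sr.
have xt m : tnth x (tperm k l m) = tnth x m by case: tpermP => // ->.
by rewrite !permM !xt.
Qed.

(** Composing a sorting permutation with the transposition of two equal entries still sorts, and
    flips the parity. *)
Lemma evenly_sorted_repeat (k l : 'I_n) x :
  k != l -> tnth x k = tnth x l -> evenly_sorted x.
Proof.
move=> neq_kl Ekl; have [r sr] := sorts_exists x.
case: (boolP (odd_perm r)) => odd_r; last by exists r.
exists (r * tperm k l)%g; last exact: sorts_tperm.
by rewrite odd_permM odd_r odd_tperm neq_kl.
Qed.

Lemma evenly_sorted_nso1 : nso1 evenly_sorted.
Proof.
move=> s x even_s [r even_r sr]; exists (r * s^-1)%g; last exact: sorts_permute.
by rewrite odd_permM odd_permV (negPf even_s) addbF.
Qed.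

Lemma evenly_sorted_nso4 : nso4 evenly_sorted.
Proof.
move=> i j x ltij; have [r sr] := sorts_exists x.
case: (boolP (odd_perm r)) => odd_r; last by left; exists r.
right; exists (r * (tperm i j)^-1)%g; last exact: sorts_permute.
by rewrite odd_permM odd_permV odd_tperm odd_r neq_ltn ltij.
Qed.

Lemma evenly_sorted_nso2 : nso2 evenly_sorted.
Proof.
move=> i j x ltij; have neq_ij : i != j by rewrite neq_ltn ltij.
split=> [[[r even_r sr] [s even_s ss]] | [k [l [ltkl Ekl]]]].
  have /injectivePn [k [l neq_kl Ekl]] : ~~ injectiveb (tnth x).
    (* For injective [x], uniqueness forces [r = s * tperm i j], although [r] and [s] are both
       even. *)
    apply/negP => /injectiveP injx; move: even_r.
    rewrite (sorts_inj injx sr (sorts_permute_inv ss)) odd_permM odd_tperm.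
    by rewrite neq_ij addbT even_s.
  by move: neq_kl; rewrite neq_ltn => /orP[] lt; [exists k, l | exists l, k].
split; first by apply: (evenly_sorted_repeat (k := k) (l := l)); rewrite ?neq_ltn ?ltkl.
apply: (evenly_sorted_repeat (k := tperm i j k) (l := tperm i j l)).
  by rewrite (inj_eq perm_inj) neq_ltn ltkl.
by rewrite !tnth_mktuple !tpermK.
Qed.

Lemma evenly_sorted_nso3 : 0 < n -> nso3 evenly_sorted.
Proof.
move=> n_gt0 x [r even_r sr] t; pose y i := tnth x (r i).
pose below i := le (y i) t.
(* [p] is the last rank whose entry is at most [t], or rank 0 if there is none, and then [lo] is
   vacuous. *)
have [p [lo hi]] : exists p : 'I_n,
    (forall i : 'I_n, i < p -> below i) /\ (forall i : 'I_n, p < i -> ~~ below i).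
  case: (pickP below) => [i0 b0 | b0].
    have [p bp maxp] := @arg_maxnP _ i0 below (fun i => i : nat) b0.
    exists p; split=> i ltpi; first exact: le_trans (sr _ _ (ltnW ltpi)) bp.
    by apply/negP => /maxp /=; rewrite leqNgt ltpi.
  by exists (Ordinal n_gt0); split=> i //; rewrite b0.
have gt_t (i : 'I_n) : p < i -> le t (y i).
  by move=> /hi; have /orP[] := le_total (y i) t; rewrite /below => ->.
exists (r p); exists r => // i j leij; rewrite !tnth_mktuple !(inj_eq perm_inj).
case: (eqVneq i p) => [Ei | neq_ip]; case: (eqVneq j p) => [Ej | neq_jp] //.
- by apply: gt_t; rewrite ltn_neqAle -Ei leij andbT Ei eq_sym.
- by apply: lo; rewrite ltn_neqAle -Ej leij andbT Ej.
- exact: sr.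
Qed.

Lemma spherical_order_evenly_sorted : 0 < n -> spherical_order evenly_sorted.
Proof.
move=> n_gt0; split.
- exact: evenly_sorted_nso1.
- exact: evenly_sorted_nso2.
- exact: evenly_sorted_nso3.
- exact: evenly_sorted_nso4.
Qed.

Lemma evenly_sorted_homo (f : T -> T) x :
  {homo f : a b / le a b} -> evenly_sorted x ->
  evenly_sorted [tuple f (tnth x i) | i < n].
Proof.
move=> homo_f [r even_r sr]; exists r => // i j leij.
by rewrite !tnth_mktuple; apply/homo_f/sr.
Qed.

End EvenlySorted.

(** * Invariant orders on torsion-free abelian groups *)

Section InvariantOrder.
Local Open Scope group_scope.
Local Open Scope classical_set_scope.
Variable G : groupType.
Implicit Types (A B M : set G) (a b g : G).

(** Membership of [1] is not demanded, so that the empty set, which is the union of the empty chain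
    in Zorn's lemma, qualifies; a maximal cone contains [1] anyway. *)
Definition semigroup_cone A : Prop :=
  (forall a b, A a -> A b -> A (a * b)) /\ (forall a, A a -> A a^-1 -> a = 1).

Lemma semigroup_cone_setU1 A : semigroup_cone A -> semigroup_cone (1 |` A).
Proof.
move=> [mulA antiA]; split=> [a b [->|Aa] [->|Ab] | a].
- by rewrite mul1g; left.
- by rewrite mul1g; right.
- by rewrite mulg1; right.
- by right; apply: mulA.
move=> [//|Aa] [E|Aa']; last exact: antiA.
by rewrite -[a]invgK E invg1.
Qed.

Lemma exists_maximal_semigroup_cone : exists M,
  [/\ semigroup_cone M, M 1
    & forall B, semigroup_cone B -> M `<=` B -> B `<=` M].
Proof.
have [|M [coneM maxM]] := @Zorn_bigcup G semigroup_cone.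
  move=> F coneF chainF; split=> [a b [A FA Aa] [B FB Bb] | a [A FA Aa] [B FB Ba]].
    have [AB|BA] := chainF _ _ FA FB.
      by exists B => //; apply: (coneF _ FB).1 => //; apply: AB.
    by exists A => //; apply: (coneF _ FA).1 => //; apply: BA.
  have [AB|BA] := chainF _ _ FA FB.
    by apply: (coneF _ FB).2 => //; apply: AB.
  by apply: (coneF _ FA).2 => //; apply: BA.
have max B : semigroup_cone B -> M `<=` B -> B `<=` M.
  by move=> coneB MB; apply: contrapT => nBM; apply: (maxM B).
exists M; split=> //; apply: (max _ (semigroup_cone_setU1 coneM)); last by left.
exact: subsetUr.
Qed.

Hypotheses (abelG : abelian_group G) (tfG : torsion_free G).

Lemma maximal_cone_pow M g :
    semigroup_cone M -> M 1 ->
    (forall B, semigroup_cone B -> M `<=` B -> B `<=` M) ->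
  ~ M g -> exists m, M (g^-1 ^+ m.+1).
Proof.
move=> [mulM antiM] M1 maxM nMg; apply: contrapT => /forallNP noM; apply: nMg.
(* [B] is the semigroup obtained by adjoining [g] to [M]; once it is shown to be a cone, maximality
   puts [g] in [M]. *)
pose B := [set a | exists p k, M p /\ a = p * g ^+ k].
apply: (maxM B); first 1 last.
- by move=> p Mp; exists p, 0%N; rewrite expg0 mulg1.
- by exists 1, 1%N; rewrite mul1g expg1.
have mulB p q k l : (p * g ^+ k) * (q * g ^+ l) = (p * q) * g ^+ (k + l)%N.
  rewrite expgnDr !mulgA; congr (_ * _); rewrite -!mulgA; congr (_ * _).
  exact: abelG.
split=> [_ _ [p [k [Mp ->]]] [q [l [Mq ->]]] | a [p [k [Mp Ea]]] [q [l [Mq Ea']]]].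
  by exists (p * q), (k + l)%N; rewrite mulB; split=> //; apply: mulM.
have Epq : p * q * g ^+ (k + l)%N = 1 by rewrite -mulB -Ea -Ea' mulgV.
(* If [k + l = 0], both [a] and [a^-1] lie in [M]; if [k + l = m.+1], then [g^-1 ^+ m.+1] equals
   [p * q], which lies in [M]. *)
case Ekl: (k + l)%N Epq => [|m] Epq.
  move/eqP: Ekl; rewrite addn_eq0 => /andP[/eqP k0 /eqP l0].
  move: Ea Ea'; rewrite k0 l0 expg0 !mulg1 => -> Eq.
  by apply: antiM; rewrite // Eq.
case: (noM m); rewrite expVgn -[X in M X]mul1g -Epq mulgK.
exact: mulM.
Qed.

Lemma exists_total_cone : exists M,
  [/\ semigroup_cone M, M 1 & forall g, M g \/ M g^-1].
Proof.
have [M [coneM M1 maxM]] := exists_maximal_semigroup_cone.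
have [mulM antiM] := coneM.
exists M; split=> // g; apply: contrapT => /not_orP [nMg nMg'].
have [m Mm] := maximal_cone_pow coneM M1 maxM nMg.
have [l Ml] := maximal_cone_pow coneM M1 maxM nMg'.
have powM a k : M a -> M (a ^+ k).
  by move=> Ma; elim: k => [|k IH]; rewrite ?expg0 // expgS; apply: mulM.
(* With the common exponent [l.+1 * m.+1], the power of [g] and its inverse both lie in [M], so this
   power is [1]. *)
have g1 : g = 1.
  apply: (tfG (m := (l.+1 * m.+1)%N)) => //; apply: antiM.
    by rewrite expgnA -[in X in M X](invgK g); apply: powM.
  by rewrite -expVgn mulnC expgnA; apply: powM.
by apply: nMg; rewrite g1.
Qed.

Lemma exists_invariant_order : exists le : rel G,
  [/\ total le, transitive le, antisymmetric le
    & forall g, {homo (fun a => g * a) : a b / le a b}].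
Proof.
have [M [[mulM antiM] M1 totM]] := exists_total_cone.
(* Left translation leaves [a^-1 * b] unchanged. *)
exists (fun a b => `[< M (a^-1 * b) >]); split.
- move=> a b; case: (totM (a^-1 * b)); first by move/asboolP->.
  by rewrite invgM invgK => /asboolP ->; rewrite orbT.
- move=> b a c /asboolP Mab /asboolP Mbc; apply/asboolP.
  by have := mulM _ _ Mab Mbc; rewrite mulgA mulgK.
- move=> a b /andP[/asboolP Mab /asboolP Mba].
  have /(canRL (mulKVg a)) : a^-1 * b = 1 by apply: antiM => //; rewrite invgM invgK.
  by rewrite mulg1.
- by move=> g a b /asboolP Mab; apply/asboolP; rewrite invgM -mulgA mulKg.
Qed.

End InvariantOrder.

Theorem theorem2p22 (G : groupType) :
  abelian_group G -> torsion_free G -> totally_s_orderable G.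
Proof.
move=> abelG tfG; apply/seteqP; split=> [n [] // | n n_gt1]; split=> //.
have n_gt0 : 0 < n by case: n n_gt1 => // n0; case: n0; left.
have [le [tot trans anti inv]] := exists_invariant_order abelG tfG.
exists (evenly_sorted le (n := n)); split.
  exact: spherical_order_evenly_sorted.
move=> x y Kx; split; last exact: evenly_sorted_homo.
(* By commutativity, right translation by [y] is left translation, hence monotone. *)
apply: (evenly_sorted_homo (f := fun a => (a * y)%g)) => // a b /(inv y).
by rewrite !(abelG y).
Qed.
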